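(* For all non-negative integers $n,k$, $$\mathscr{S}(n,k) = \sum_{m=0}^{n}\binom{n}{m}\,\mathscr{T}(m,k)\,S_{n-m},$$ where $\mathscr{T}(n,k)$ are the higher-order tangent numbers, $\mathscr{S}(n,k)$ are the higher-order secant numbers and $S_n$ are the secant numbers.
   Context: For non-negative integers $n,k$, the higher-order tangent numbers $\mathscr{T}(n,k)$ and higher-order secant numbers $\mathscr{S}(n,k)$ are defined by the power series expansions $\frac{\tan^{k}t}{k!} = \sum_{n=k}^{\infty}\mathscr{T}(n,k)\frac{t^n}{n!}$ and $\frac{\sec t\,\tan^{k}t}{k!} = \sum_{n=k}^{\infty}\mathscr{S}(n,k)\frac{t^n}{n!}$, with $\mathscr{T}(n,k)=\mathscr{S}(n,k)=0$ for $n<k$. The secant numbers are $S_n:=\mathscr{S}(n,0)$, i.e. $\sec t=\sum_{n\ge0}S_n\frac{t^n}{n!}$. *)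

(* Defs.v *)
From Stdlib Require Import Arith Factorial Reals Lra Lia ClassicalEpsilon.
From Coquelicot Require Import Coquelicot.
Open Scope R_scope.

Definition is_egf (a : nat -> R) (f : R -> R) : Prop :=
  locally 0 (fun t => is_pseries (fun n => a n / INR (fact n)) t (f t)).

(* Meaningful only when f has a power series expansion at 0, in which case the
   sequence is unique ([is_egf_unique]); the expansions used below do exist
   ([tangent_egf], [secant_egf]). *)
Definition egf_coeff (f : R -> R) : nat -> R :=
  epsilon (inhabits (fun _ => 0)) (fun a => is_egf a f).

Definition sec (t : R) : R := / cos t.

(* The convention that these numbers vanish for n < k is a consequence of the
   expansions: see [tangent_small] and [secant_small]. *)
Definition tangent (n k : nat) : R :=
  egf_coeff (fun t => tan t ^ k / INR (fact k)) n.

Definition secant (n k : nat) : R :=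
  egf_coeff (fun t => sec t * tan t ^ k / INR (fact k)) n.

Definition secant_number (n : nat) : R := secant n 0.

Lemma locally_pseries_radius (a : nat -> R) (f : R -> R) :
  locally 0 (fun t => is_pseries a t (f t)) -> Rbar_lt 0 (CV_radius a).
Proof.
intros [e He].
assert (He0 := cond_pos e).
assert (H : is_pseries a (e / 2) (f (e / 2))).
{ apply He. unfold ball; simpl; unfold AbsRing_ball, abs, minus, plus, opp; simpl.
  rewrite Rabs_pos_eq; lra. }
destruct (Rbar_lt_dec 0 (CV_radius a)) as [|n]; [assumption|exfalso].
apply (CV_disk_outside a (e / 2)).
- apply Rbar_le_lt_trans with 0.
  + apply Rbar_not_lt_le, n.
  + simpl. rewrite Rabs_pos_eq; lra.
- apply ex_series_lim_0. exists (f (e / 2)). now apply is_pseries_R.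
Qed.

Lemma locally_radius (a : nat -> R) :
  Rbar_lt 0 (CV_radius a) -> locally 0 (fun t => Rbar_lt (Rabs t) (CV_radius a)).
Proof.
intros H. destruct (CV_radius a) as [r| |] eqn:E; simpl in *; try tauto.
- exists (mkposreal r H). intros y Hy.
  unfold ball in Hy; simpl in Hy; unfold AbsRing_ball, abs, minus, plus, opp in Hy;
    simpl in Hy. now rewrite Ropp_0, Rplus_0_r in Hy.
- exists (mkposreal 1 Rlt_0_1). intros; exact I.
Qed.

Lemma is_egf_unique (a b : nat -> R) (f : R -> R) :
  is_egf a f -> is_egf b f -> forall n, a n = b n.
Proof.
intros Ha Hb n.
assert (H : a n / INR (fact n) = b n / INR (fact n)).
{ apply (PSeries_ext_recip (fun n => a n / INR (fact n))
           (fun n => b n / INR (fact n)) n).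
  - eapply locally_pseries_radius; exact Ha.
  - eapply locally_pseries_radius; exact Hb.
  - generalize (filter_and _ _ Ha Hb). apply filter_imp. intros t [h1 h2].
    now rewrite (is_pseries_unique _ _ _ h1), (is_pseries_unique _ _ _ h2). }
assert (F := INR_fact_neq_0 n).
apply (Rmult_eq_reg_r (/ INR (fact n))); [exact H|now apply Rinv_neq_0_compat].
Qed.

Definition expands (k : nat) (f : R -> R) : Prop :=
  exists a : nat -> R, (forall n, (n < k)%nat -> a n = 0) /\
    locally 0 (fun t => is_pseries a t (f t)).

Lemma expands_ext (k : nat) (f g : R -> R) :
  (forall t, f t = g t) -> expands k f -> expands k g.
Proof.
intros E [a [Ha H]]. exists a. split; [exact Ha|].
revert H. apply filter_imp. intros t. now rewrite E.
Qed.

Lemma expands_scal (k : nat) (c : R) (f : R -> R) :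
  expands k f -> expands k (fun t => f t * c).
Proof.
intros [a [Ha H]]. exists (PS_scal c a). split.
- intros n Hn. unfold PS_scal, scal; simpl; unfold mult; simpl. rewrite Ha; auto; ring.
- revert H. apply filter_imp. intros t Ht.
  rewrite Rmult_comm. apply (is_pseries_scal c a t (f t)); [apply Rmult_comm|exact Ht].
Qed.

Lemma expands_mult (k l : nat) (f g : R -> R) :
  expands k f -> expands l g -> expands (k + l) (fun t => f t * g t).
Proof.
intros [a [Ha Hf]] [b [Hb Hg]]. exists (PS_mult a b). split.
- intros n Hn. unfold PS_mult. rewrite <- (sum_eq_R0 (fun _ => 0) n) by auto.
  apply sum_eq. intros i Hi.
  destruct (Compare_dec.le_lt_dec k i).
  + rewrite (Hb (n - i)%nat) by lia. ring.
  + rewrite (Ha i) by lia. ring.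
- generalize (filter_and _ _ (filter_and _ _ Hf Hg)
    (filter_and _ _ (locally_radius _ (locally_pseries_radius _ _ Hf))
                    (locally_radius _ (locally_pseries_radius _ _ Hg)))).
  apply filter_imp. intros t [[h1 h2] [h3 h4]]. now apply is_pseries_mult.
Qed.

Definition cos_coeff (n : nat) : R :=
  if Nat.even n then (-1) ^ (Nat.div2 n) / INR (fact n) else 0.
Definition sin_coeff (n : nat) : R :=
  if Nat.even n then 0 else (-1) ^ (Nat.div2 n) / INR (fact n).

Lemma is_pseries_zero (x : R) : is_pseries (fun _ => 0) x 0.
Proof.
apply is_pseries_R. apply is_series_Reals. intros e He. exists 0%nat. intros n _.
rewrite sum_eq_R0 by (intros; ring). unfold Rdist. rewrite Rminus_0_r, Rabs_R0. lra.
Qed.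

Lemma is_pseries_one (x : R) :
  is_pseries (fun n => match n with O => 1 | _ => 0 end) x 1.
Proof.
apply is_pseries_R, is_series_Reals. intros e He. exists 0%nat. intros n _.
assert (E : sum_f_R0 (fun n => match n with O => 1 | _ => 0 end * x ^ n) n = 1).
{ induction n as [|n IH]; [simpl; ring|]. rewrite tech5, IH. ring. }
refine (eq_ind_r (fun v => Rdist v 1 < e) _ E). unfold Rdist. rewrite Rminus_diag, Rabs_R0. lra.
Qed.

Lemma cos_pseries (x : R) : is_pseries cos_coeff x (cos x).
Proof.
replace (cos x) with (cos x + x * 0) by ring.
apply is_pseries_odd_even.
- unfold cos. destruct (exist_cos (Rsqr x)) as [l Hl]. unfold cos_in in Hl.
  apply is_pseries_R, is_series_Reals. rewrite <- Rsqr_pow2.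
  intros e He. destruct (Hl e He) as [N HN]. exists N. intros n Hn.
  rewrite (sum_eq _ (fun i => cos_n i * Rsqr x ^ i)); [now apply HN|].
  intros i _. unfold cos_coeff, cos_n.
  rewrite Nat.even_mul, Nat.div2_double. reflexivity.
- apply is_pseries_ext with (fun _ : nat => 0); [|apply is_pseries_zero].
  intros n. unfold cos_coeff. now rewrite Nat.even_add, Nat.even_mul.
Qed.

Lemma sin_pseries (x : R) : is_pseries sin_coeff x (sin x).
Proof.
unfold sin. destruct (exist_sin (Rsqr x)) as [l Hl]. unfold sin_in in Hl.
replace (x * l) with (0 + x * l) by ring.
apply is_pseries_odd_even.
- apply is_pseries_ext with (fun _ : nat => 0); [|apply is_pseries_zero].
  intros n. unfold sin_coeff. now rewrite Nat.even_mul.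
- apply is_pseries_R, is_series_Reals. rewrite <- Rsqr_pow2.
  intros e He. destruct (Hl e He) as [N HN]. exists N. intros n Hn.
  rewrite (sum_eq _ (fun i => sin_n i * Rsqr x ^ i)); [now apply HN|].
  intros i _. unfold sin_coeff, sin_n.
  rewrite Nat.even_add, Nat.even_mul. cbn [Nat.even orb Bool.eqb].
  rewrite Nat.add_1_r, Nat.div2_succ_double. reflexivity.
Qed.

Fixpoint inv_prefix (c : nat -> R) (n : nat) : nat -> R :=
  match n with
  | O => fun _ => 1
  | S p => fun m => if Nat.leb m p then inv_prefix c p m
      else - sum_f_R0 (fun j => c (S j) * inv_prefix c p (p - j)%nat) p
  end.
Definition inv_coeff (c : nat -> R) (n : nat) : R := inv_prefix c n n.

Lemma inv_prefix_le (c : nat -> R) (n m : nat) :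
  (m <= n)%nat -> inv_prefix c n m = inv_coeff c m.
Proof.
induction n as [|n IH]; intros H.
- replace m with 0%nat by lia. reflexivity.
- destruct (Nat.eq_dec m (S n)) as [->|E]; [reflexivity|].
  simpl. destruct (Nat.leb_spec m n); [apply IH; lia|lia].
Qed.

Lemma inv_coeff_S (c : nat -> R) (n : nat) :
  inv_coeff c (S n) = - sum_f_R0 (fun j => c (S j) * inv_coeff c (n - j)%nat) n.
Proof.
unfold inv_coeff at 1. cbn [inv_prefix].
destruct (Nat.leb_spec (S n) n); [lia|]. f_equal.
apply sum_eq. intros i Hi. rewrite inv_prefix_le by lia. reflexivity.
Qed.

Lemma inv_coeff_bound (c : nat -> R) :
  (forall n, Rabs (c n) <= 1) -> forall n, Rabs (inv_coeff c n) <= 2 ^ n.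
Proof.
intros Hc n. induction n as [n IH] using lt_wf_ind. destruct n as [|n].
- unfold inv_coeff; simpl. rewrite Rabs_R1. lra.
- rewrite inv_coeff_S, Rabs_Ropp.
  apply Rle_trans with (sum_f_R0 (fun j => 2 ^ (n - j)) n).
  + eapply Rle_trans; [apply Rsum_abs|]. apply sum_Rle. intros j Hj.
    rewrite Rabs_mult, <- (Rmult_1_l (2 ^ _)).
    apply Rmult_le_compat; try apply Rabs_pos; auto. apply IH. lia.
  + assert (G : sum_f_R0 (fun j => 2 ^ (n - j)) n = 2 ^ S n - 1); [|lra].
    clear. induction n as [|n IH]; [simpl; ring|].
    rewrite decomp_sum by lia. simpl pred.
    rewrite (sum_eq _ (fun j => 2 ^ (n - j))) by (intros; reflexivity).
    rewrite IH. simpl. ring.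
Qed.

Lemma cos_coeff_bound (n : nat) : Rabs (cos_coeff n) <= 1.
Proof.
unfold cos_coeff. destruct (Nat.even n); [|rewrite Rabs_R0; lra].
assert (F := INR_fact_lt_0 n).
unfold Rdiv. rewrite Rabs_mult, pow_1_abs, Rmult_1_l, Rabs_inv, (Rabs_pos_eq _ (Rlt_le _ _ F)).
rewrite <- Rinv_1. apply Rinv_le_contravar; [lra|].
apply (le_INR 1). generalize (lt_O_fact n). lia.
Qed.

Lemma sec_expands : expands 0 sec.
Proof.
set (s := inv_coeff cos_coeff).
assert (Rs : Rbar_lt 0 (CV_radius s)).
{ apply Rbar_lt_le_trans with (/ 2); [simpl; lra|].
  apply (proj1 (CV_radius_bounded s)). exists 1. intros n.
  rewrite Rabs_mult, <- RPow_abs, (Rabs_pos_eq (/ 2)), pow_inv by lra.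
  assert (P : 0 < 2 ^ n) by (apply pow_lt; lra).
  apply (Rmult_le_reg_r (2 ^ n)); [exact P|].
  rewrite Rmult_assoc, Rinv_l by lra.
  generalize (inv_coeff_bound _ cos_coeff_bound n). fold s. lra. }
exists s. split; [lia|].
assert (Hc : locally 0 (fun t => is_pseries cos_coeff t (cos t)))
  by (apply filter_forall; apply cos_pseries).
generalize (filter_and _ _ (locally_radius _ Rs)
  (locally_radius _ (locally_pseries_radius _ _ Hc))).
apply filter_imp. intros t [h1 h2].
assert (h3 := PSeries_correct _ _ (CV_radius_inside _ _ h1)).
assert (h4 := is_pseries_mult _ _ _ _ _ (cos_pseries t) h3 h2 h1).
assert (E : cos t * PSeries s t = 1).
{ rewrite <- (is_pseries_unique _ _ _ h4). apply is_pseries_unique.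
  apply is_pseries_ext with (fun n => match n with O => 1 | _ => 0 end);
    [|apply is_pseries_one].
  intros [|n].
  - unfold PS_mult, s, inv_coeff, cos_coeff; simpl. field.
  - unfold PS_mult. rewrite decomp_sum by lia. simpl pred. fold s.
    replace (s (S n - 0)%nat) with
      (- sum_f_R0 (fun i => cos_coeff (S i) * s (S n - S i)%nat) n)
      by (symmetry; apply inv_coeff_S).
    replace (cos_coeff 0) with 1 by (unfold cos_coeff; simpl; field).
    match goal with |- ?a = ?b => change (@eq R 0 b) end. ring. }
replace (sec t) with (PSeries s t); [exact h3|].
unfold sec. assert (cos t <> 0) by (intros K; rewrite K in E; lra).
apply (Rmult_eq_reg_l (cos t)); [|assumption]. rewrite E, Rinv_r; auto.
Qed.

Lemma sin_expands : expands 1 sin.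
Proof.
exists sin_coeff. split.
- intros n Hn. replace n with 0%nat by lia. reflexivity.
- apply filter_forall. apply sin_pseries.
Qed.

Lemma tan_pow_expands (k : nat) : expands k (fun t => tan t ^ k).
Proof.
induction k as [|k IH].
- exists (fun n => match n with O => 1 | _ => 0 end). split; [lia|].
  apply filter_forall. intros t. apply is_pseries_one.
- apply (expands_ext (1 + 0 + k) (fun t => sin t * sec t * tan t ^ k)).
  + reflexivity.
  + apply expands_mult; [|exact IH].
    apply (expands_mult 1 0); [apply sin_expands|apply sec_expands].
Qed.

Lemma expands_egf_coeff (k : nat) (f : R -> R) : expands k f ->
  is_egf (egf_coeff f) f /\ forall n, (n < k)%nat -> egf_coeff f n = 0.
Proof.
intros [a [Ha H]].
assert (Hb : is_egf (fun n => a n * INR (fact n)) f).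
{ unfold is_egf. revert H. apply filter_imp. intros t. apply is_pseries_ext. intros n.
  match goal with |- ?a = ?b => change (@eq R a b) end.
  field. apply INR_fact_neq_0. }
assert (Hs : is_egf (egf_coeff f) f).
{ unfold egf_coeff. apply epsilon_spec. now exists (fun n => a n * INR (fact n)). }
split; [exact Hs|]. intros n Hn.
rewrite (is_egf_unique _ _ _ Hs Hb n), Ha by exact Hn. ring.
Qed.

Lemma tangent_expands (k : nat) : expands k (fun t => tan t ^ k / INR (fact k)).
Proof. apply (expands_scal k (/ INR (fact k))), tan_pow_expands. Qed.

Lemma secant_expands (k : nat) :
  expands k (fun t => sec t * tan t ^ k / INR (fact k)).
Proof.
apply (expands_scal k (/ INR (fact k)) (fun t => sec t * tan t ^ k)).
apply (expands_mult 0 k); [apply sec_expands|apply tan_pow_expands].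
Qed.

Lemma tangent_egf (k : nat) :
  is_egf (fun n => tangent n k) (fun t => tan t ^ k / INR (fact k)).
Proof. exact (proj1 (expands_egf_coeff _ _ (tangent_expands k))). Qed.

Lemma secant_egf (k : nat) :
  is_egf (fun n => secant n k) (fun t => sec t * tan t ^ k / INR (fact k)).
Proof. exact (proj1 (expands_egf_coeff _ _ (secant_expands k))). Qed.

Lemma tangent_small (n k : nat) : (n < k)%nat -> tangent n k = 0.
Proof. exact (proj2 (expands_egf_coeff _ _ (tangent_expands k)) n). Qed.

Lemma secant_small (n k : nat) : (n < k)%nat -> secant n k = 0.
Proof. exact (proj2 (expands_egf_coeff _ _ (secant_expands k)) n). Qed.

(* Main.v *)
Require Import Defs.
From Stdlib Require Import Reals.
From Coquelicot Require Import Coquelicot.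
Open Scope R_scope.

(** The functions whose expansions define the three families satisfy
    [sec t * tan t ^ k / k! = (tan t ^ k / k!) * sec t].  A product of functions
    has the binomial convolution of the coefficient sequences as exponential
    coefficients ([is_egf_mult]), so both sides of the theorem are exponential
    coefficients of the same function, and these are unique ([is_egf_unique]). *)

Lemma is_egf_ext (a : nat -> R) (f g : R -> R) :
  (forall t, f t = g t) -> is_egf a f -> is_egf a g.
Proof.
unfold is_egf. intros E. apply filter_imp. intros t. now rewrite E.
Qed.

(** This is the Cauchy product of power series, valid near 0 because both series
    converge absolutely there; the weights come from
    [n! / (m! (n - m)!) = Binomial.C n m]. *)
Lemma is_egf_mult (a b : nat -> R) (f g : R -> R) :
  is_egf a f -> is_egf b g ->
  is_egf (fun n => sum_f_R0 (fun m => Binomial.C n m * a m * b (n - m)%nat) n)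
    (fun t => f t * g t).
Proof.
intros Hf Hg.
unfold is_egf in *.
generalize (filter_and _ _ (filter_and _ _ Hf Hg)
  (filter_and _ _ (locally_radius _ (locally_pseries_radius _ _ Hf))
                  (locally_radius _ (locally_pseries_radius _ _ Hg)))).
apply filter_imp. intros t [[h1 h2] [h3 h4]].
apply is_pseries_ext with (2 := is_pseries_mult _ _ _ _ _ h1 h2 h3 h4).
intros n. unfold PS_mult, Rdiv at 3. rewrite Rmult_comm, scal_sum.
apply sum_eq. intros m _. unfold Binomial.C.
field. repeat split; apply INR_fact_neq_0.
Qed.

Theorem proposition3 (n k : nat) :
  secant n k =
  sum_f_R0 (fun m : nat =>
    Binomial.C n m * tangent m k * secant_number (n - m)%nat) n.
Proof.
assert (H := is_egf_mult _ _ _ _ (tangent_egf k) (secant_egf 0)).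
refine (is_egf_unique _ _ _ (secant_egf k) (is_egf_ext _ _ _ _ H) n).
intros t. simpl. field. apply INR_fact_neq_0.
Qed.
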